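(* Let $\theta>0$ and $\varepsilon\in(0,1)$. For any fixed decision $\mathbf{x}\in\mathcal{X}$, the ambiguous chance constraint $$\sup_{\mathbb{P}\in\mathcal{F}(\theta)}\mathbb{P}[\tilde{\boldsymbol{\xi}}\notin\mathcal{S}(\mathbf{x})]\le\varepsilon$$ over the Wasserstein ambiguity set $\mathcal{F}(\theta)$ is satisfied if and only if $$\frac1N\sum_{i=1}^{\varepsilon N}\mathbf{dist}\big(\hat{\boldsymbol{\xi}}_{\pi_i(\mathbf{x})},\bar{\mathcal{S}}(\mathbf{x})\big)\ge\theta .$$
   Context: Setting. $\|\cdot\|$ is an arbitrary norm on $\mathbb{R}^K$, and $\mathcal{P}(\mathbb{R}^K)$ is the set of all probability distributions on $\mathbb{R}^K$. For $\mathbb{P}_1,\mathbb{P}_2\in\mathcal{P}(\mathbb{R}^K)$ the (type-1) Wasserstein distance is $d_{\rm W}(\mathbb{P}_1,\mathbb{P}_2)=\inf_{\mathbb{P}\in\mathcal{P}(\mathbb{P}_1,\mathbb{P}_2)}\mathbb{E}_{\mathbb{P}}[\|\tilde{\boldsymbol{\xi}}_1-\tilde{\boldsymbol{\xi}}_2\|]$, where $\mathcal{P}(\mathbb{P}_1,\mathbb{P}_2)$ is the set of all distributions of $(\tilde{\boldsymbol{\xi}}_1,\tilde{\boldsymbol{\xi}}_2)$ on $\mathbb{R}^K\times\mathbb{R}^K$ with marginals $\mathbb{P}_1$ and $\mathbb{P}_2$. Given training samples $\hat{\boldsymbol{\xi}}_1,\dots,\hat{\boldsymbol{\xi}}_N\in\mathbb{R}^K$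 ($N\ge1$), let $\hat{\mathbb{P}}=\frac1N\sum_{i=1}^N\delta_{\hat{\boldsymbol{\xi}}_i}$ be the empirical distribution, and define the Wasserstein ambiguity set $\mathcal{F}(\theta)=\{\mathbb{P}\in\mathcal{P}(\mathbb{R}^K)\mid d_{\rm W}(\mathbb{P},\hat{\mathbb{P}})\le\theta\}$. $\mathcal{X}\subseteq\mathbb{R}^L$ is a compact polyhedron. For each $\mathbf{x}\in\mathcal{X}$, $\mathcal{S}(\mathbf{x})\subseteq\mathbb{R}^K$ is an arbitrary open set (safety set) and $\bar{\mathcal{S}}(\mathbf{x})=\mathbb{R}^K\setminus\mathcal{S}(\mathbf{x})$ is its closed complement (unsafe set). For a closed set $\mathcal{C}\subseteq\mathbb{R}^K$, $\mathbf{dist}(\hat{\boldsymbol{\xi}},\mathcal{C})=\min\{\|\boldsymbol{\xi}-\hat{\boldsymbol{\xi}}\|\mid\boldsymbol{\xi}\in\mathcal{C}\}$, with the convention that this equals $+\infty$ if $\mathcal{C}=\emptyset$. $\boldsymbol{\pi}(\mathbf{x})=(\pi_1(\mathbf{x}),\dots,\pi_N(\mathbf{x}))$ is a permutation of $\{1,\dots,N\}$ ordering the samples by increasing distance to the unsafe set: $\mathbf{dist}(\hat{\boldsymbol{\xi}}_{\pi_1(\mathbf{x})},\bar{\mathcal{S}}(\mathbf{x}))\le\dots\le\mathbf{dist}(\hat{\boldsymbol{\xi}}_{\pi_N(\mathbf{x})},\bar{\mathcal{S}}(\mathbf{x}))$. Partial sums with fractional upper limit: for real $\ell\in[0,N]$,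 $\sum_{i=1}^{\ell}k_i=\sum_{i=1}^{\lfloor\ell\rfloor}k_i+(\ell-\lfloor\ell\rfloor)k_{\lfloor\ell\rfloor+1}$ (the last term being $0$ when $\ell$ is an integer). *)

(* Defs.v *)
From HB Require Import structures.
From mathcomp Require Import all_boot all_order all_algebra perm.
From mathcomp Require Import all_classical all_reals all_analysis.
Import Order.TTheory GRing.Theory Num.Theory.
Import numFieldNormedType.Exports.

Set Implicit Arguments.
Unset Strict Implicit.
Unset Printing Implicit Defensive.

Local Open Scope classical_set_scope.
Local Open Scope ring_scope.
Local Open Scope ereal_scope.

Record is_norm (R : realType) (K : nat) (nrm : 'rV[R]_K -> R) : Prop := IsNorm {
  norm_triangle : forall x y, (nrm (x + y) <= nrm x + nrm y)%R ;
  norm_homogeneous : forall (a : R) x, nrm (a *: x)%R = (`|a| * nrm x)%R ;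
  norm_definite : forall x, nrm x = 0%R -> x = 0%R }.

(* R^K with its Borel sigma-algebra. The library topology on 'rV[R]_K comes
   from the sup norm; all norms on R^K induce this same topology. *)
Notation borel_rV R K := (g_sigma_algebraType (@open 'rV[R]_K)).

Section wasserstein.
Context (R : realType) (K : nat).
Local Notation T := (borel_rV R K).
Implicit Types (nrm : 'rV[R]_K -> R) (P : probability T R).

Definition coupling P1 P2 : set (probability (T * T)%type R) :=
  [set Q | (forall A : set T, measurable A -> Q (fst @^-1` A) = P1 A) /\
           (forall A : set T, measurable A -> Q (snd @^-1` A) = P2 A)].

(* Extended-real valued: P1 and P2 need not have finite first moments. *)
Definition wasserstein nrm P1 P2 : \bar R :=
  ereal_inf [set 'E_Q[fun z : T * T => nrm ((z.1 : 'rV[R]_K) - z.2)%R]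
            | Q in coupling P1 P2].

(* The infimum over a nonempty closed C is attained, and ereal_inf set0 = +oo. *)
Definition dist nrm (xi : 'rV[R]_K) (C : set 'rV[R]_K) : \bar R :=
  ereal_inf [set (nrm (x - xi)%R)%:E | x in C].

End wasserstein.

(* N0 does not occur in the formula; it is what makes the result a probability. *)
Definition empirical (R : realType) (K N : nat) (N0 : (0 < N)%N)
    (xi : 'I_N -> 'rV[R]_K) (A : set (borel_rV R K)) : \bar R :=
  (N%:R^-1)%:E * \sum_(i < N) \d_(xi i : borel_rV R K) A.

Section empirical.
Context (R : realType) (K N : nat) (N0 : (0 < N)%N) (xi : 'I_N -> 'rV[R]_K).
Local Notation T := (borel_rV R K).
Local Notation emp := (empirical N0 xi).

Let m : {measure set T -> \bar R} :=
  mscale (N%:R^-1)%:nng%R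
    (msum (fun n => dirac (xi (insubd (Ordinal N0) n) : T)) N).

Let empE : emp = m.
Proof.
apply/funext => A; rewrite /emp /m /= /mscale /msum /=; congr (_ * _).
by apply: eq_bigr => i _; rewrite valKd.
Qed.

Let emp0 : emp set0 = 0. Proof. by rewrite empE measure0. Qed.
Let emp_ge0 A : 0 <= emp A. Proof. by rewrite empE measure_ge0. Qed.
Let emp_sigma_additive : semi_sigma_additive emp.
Proof. by rewrite empE; exact: measure_semi_sigma_additive. Qed.

HB.instance Definition _ :=
  isMeasure.Build _ _ _ emp emp0 emp_ge0 emp_sigma_additive.

Let emp_setT : emp setT = 1.
Proof.
rewrite /empirical (eq_bigr (fun=> 1%:E)); last by move=> i _; rewrite diracT.
rewrite sumEFin sumr_const card_ord -EFinM mulVf //.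
by rewrite pnatr_eq0 -lt0n.
Qed.

HB.instance Definition _ := Measure_isProbability.Build _ _ _ emp emp_setT.

End empirical.

Definition ambiguity_set (R : realType) (K N : nat) (N0 : (0 < N)%N)
    (nrm : 'rV[R]_K -> R) (xi : 'I_N -> 'rV[R]_K) (theta : R)
    : set (probability (borel_rV R K) R) :=
  [set P | wasserstein nrm P (empirical N0 xi) <= theta%:E].

Definition polyhedron (R : realType) (L : nat) (X : set 'rV[R]_L) : Prop :=
  exists m (A : 'M[R]_(L, m)) (b : 'rV[R]_m),
    X = [set x | forall j, ((x *m A) ord0 j <= b ord0 j)%R].

(* The sum of k up to a real upper limit l in [0, N]. Indices start at 0, so
   the fractional term carries index floor(l); that sum is empty if l = N.
   Since 0 * +oo = 0 in \bar R, the term vanishes for integral l. *)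
Definition fractional_sum (R : realType) (N : nat) (l : R) (k : 'I_N -> \bar R)
    : \bar R :=
  \sum_(i < N | (i < Num.truncn l)%N) k i +
  (l - (Num.truncn l)%:R)%:E * \sum_(i < N | i == Num.truncn l :> nat) k i.

(* Main.v *)
From HB Require Import structures.
Require Import Defs.
From mathcomp Require Import all_boot all_order all_algebra perm.
From mathcomp Require Import all_classical all_reals all_analysis.
From mathcomp Require Import measurable_realfun ring lra.
Import Order.TTheory GRing.Theory Num.Theory.
Import numFieldNormedType.Exports.

(** Write [C] for the unsafe set, [d] for the distance to [C], [d_0 <= d_1 <= ...]
for its sorted values at the samples, [l = eps * N] and [m] for the integral part
of [l]. Moving mass from a sample into [C] costs at least [d] per unit, so the
cheapest way of putting mass [eps] into [C] is greedy: move the whole mass [1/N]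
of each of the [m] samples closest to [C], then the fraction [l - m] of the next
one. The right-hand side of the theorem is exactly that cost, and the theorem
compares it with the budget [theta].

Suppose first that the greedy cost is at least [theta] ([chance_le]).
With [lam = d_m] one has, for all [z1] and [z2],
[lam * \1_C z1 <= nrm (z1 - z2) + max 0 (lam - d z2)],
and integrating against any coupling (weak Kantorovich duality,
[kantorovich_weak_duality]) bounds [lam * P C] by the transport cost plus the
empirical mean of [max 0 (lam - d)]. The greedy weights are complementary to
this dual function ([greedy_complementary]), so that the bound reads
[lam * (P C - eps) <= W(P, empirical) - greedy cost], whence [P C <= eps].

Conversely ([chance_gt]), if the greedy cost is below [theta], there is room to
move slightly more than [eps] into nearly closest points of [C]. The result is a
discrete distribution, coupled with the empirical one by the transport plan
itself ([partial_transport]).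

Pairs carry the sigma-algebra generated by rectangles, while continuity of the
cost [nrm (z1 - z2)] speaks of open sets of pairs. To avoid comparing the two,
expected costs are handled through the definition of the integral of a
nonnegative function as a supremum over the simple functions below it, which
gives monotonicity, and upper bounds against discrete measures, for arbitrary
nonnegative functions. *)

Set Implicit Arguments.
Unset Strict Implicit.

Local Open Scope classical_set_scope.
Local Open Scope ring_scope.
Local Open Scope ereal_scope.

(** * Integrals of nonnegative functions that may fail to be measurable *)

Lemma ge0_le_integral_nomeas d (T : measurableType d) (R : realType)
    (mu : {measure set T -> \bar R}) (f g : T -> \bar R) :
  (forall x, 0 <= f x) -> (forall x, f x <= g x) ->
  \int[mu]_x f x <= \int[mu]_x g x.
Proof.
move=> f0 fg; have g0 x : 0 <= g x := le_trans (f0 x) (fg x).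
rewrite !ge0_integralTE//; apply: le_ereal_sup => _ [h hf <-].
by exists h => // x; exact: le_trans (hf x) (fg x).
Qed.

(** * Finitely supported measures *)

Section discrete_measure.
Import HBNNSimple.
Context d (T : measurableType d) (R : realType) (I : finType).
Variables (c : I -> {nonneg R}%R) (p : I -> T).

(** Finite sums of measures are indexed by [nat] in [msum]; the [n]-th summand
is the atom of the [n]-th element of [I] in its enumeration. *)
Definition discrete_atom (n : nat) : {measure set T -> \bar R} :=
  if insub n is Some i
  then mscale (c (@enum_val _ I i)) \d_(p (enum_val i)) else mzero.

Let discreteE (F : {measure set T -> \bar R} -> \bar R) :
  \sum_(n < #|I|) F (discrete_atom n) =
  \sum_i F (mscale (c i) \d_(p i)).
Proof.
rewrite [RHS](reindex (@enum_val _ I)); last exact/onW_bij/enum_val_bij.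
by apply: eq_bigr => i _; rewrite /discrete_atom valK.
Qed.

Lemma discrete_measureE A :
  msum discrete_atom #|I| A = \sum_i (c i)%:num%:E * \d_(p i) A.
Proof. by rewrite /msum (discreteE (fun m => m A)). Qed.

Lemma integral_discrete (mu : {measure set T -> \bar R}) (f : T -> \bar R) :
  (forall A, measurable A -> mu A = \sum_i (c i)%:num%:E * \d_(p i) A) ->
  (forall x, 0 <= f x) -> measurable_fun setT f ->
  \int[mu]_x f x = \sum_i (c i)%:num%:E * f (p i).
Proof.
move=> muE f0 mf.
rewrite (eq_measure_integral (msum discrete_atom #|I|)); last first.
  by move=> A mA _; rewrite muE// -discrete_measureE.
rewrite ge0_integral_measure_sum//.
rewrite (discreteE (fun m => \int[m]_x f x)); apply: eq_bigr => i _.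
by rewrite ge0_integral_mscale// integral_dirac// diracT mul1e.
Qed.

(** An inequality only, for arbitrary nonnegative [f]: each simple function below
[f] is measurable, and is below [f] at each atom. *)
Lemma integral_discrete_le (mu : {measure set T -> \bar R}) (f : T -> \bar R) :
  (forall A, measurable A -> mu A = \sum_i (c i)%:num%:E * \d_(p i) A) ->
  (forall x, 0 <= f x) ->
  \int[mu]_x f x <= \sum_i (c i)%:num%:E * f (p i).
Proof.
move=> muE f0; rewrite ge0_integralTE//.
apply: ge_ereal_sup => _ [h hf <-].
rewrite -integralT_nnsfun (integral_discrete muE); first last.
- exact/measurable_EFinP.
- by move=> x; rewrite lee_fin.
by apply: lee_sum => i _; apply: lee_wpmul2l => //; rewrite lee_fin.
Qed.

Lemma discrete_probability : (\sum_i (c i)%:num = 1)%R ->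
  exists P : probability T R, forall A,
    P A = \sum_i (c i)%:num%:E * \d_(p i) A.
Proof.
move=> c1.
have m1 : msum discrete_atom #|I| setT = 1.
  rewrite discrete_measureE (eq_bigr (fun i => (c i)%:num%:E)).
    by rewrite sumEFin c1.
  by move=> i _; rewrite diracT mule1.
pose P : probability T R := HB.pack_for (probability T R)
  (msum discrete_atom #|I|)
  (Measure_isProbability.Build _ _ _ (msum discrete_atom #|I|) m1).
by exists P => A; rewrite -discrete_measureE.
Qed.

End discrete_measure.

(** * Weak duality for optimal transport *)

(** Only the part [max 0 (phi x - g y)] of the cost is charged. It lies below [c]
and is measurable whatever [c] is, so additivity of the integral applies to it. *)
Lemma kantorovich_weak_duality (R : realType) (K : nat)
    (P1 P2 : probability (borel_rV R K) R)
    (Q : probability (borel_rV R K * borel_rV R K)%type R)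
    (phi g : borel_rV R K -> R) (c : borel_rV R K * borel_rV R K -> R) :
  coupling P1 P2 Q ->
  measurable_fun setT phi -> measurable_fun setT g ->
  (forall x, 0 <= phi x)%R -> (forall x, 0 <= g x)%R ->
  (forall z, 0 <= c z)%R ->
  (forall x y, phi x <= c (x, y) + g y)%R ->
  \int[P1]_x (phi x)%:E <= 'E_Q[c] + \int[P2]_x (g x)%:E.
Proof.
move=> [Q1 Q2] mphi mg phi0 g0 c0 phicg.
pose T := borel_rV R K.
have marg (f : T -> R) (pr : T * T -> T) (P : probability T R) :
    measurable_fun setT pr ->
    (forall A, measurable A -> Q (pr @^-1` A) = P A) ->
    measurable_fun setT f -> (forall x, 0 <= f x)%R ->
    \int[P]_x (f x)%:E = \int[Q]_z (f (pr z))%:E.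
  move=> mpr QP mf f0.
  rewrite (eq_measure_integral (pushforward Q pr)); last first.
    by move=> A mA _; exact: esym (QP A mA).
  rewrite ge0_integral_pushforward//; first exact/measurable_EFinP.
  by move=> y _; rewrite lee_fin.
rewrite (marg phi fst)// (marg g snd)//.
pose h z : R := Num.max 0%R (phi z.1 - g z.2)%R.
have h0 z : (0 <= h z)%R by rewrite le_max lexx.
have m1 : measurable_fun setT (phi \o fst : T * T -> R).
  exact: measurableT_comp.
have m2 : measurable_fun setT (g \o snd : T * T -> R).
  exact: measurableT_comp.
have mh : measurable_fun setT h.
  by apply: measurable_maxr => //; exact: measurable_funB.
apply: (@le_trans _ _ (\int[Q]_z ((h z)%:E + (g z.2)%:E))).
  apply: ge0_le_integral_nomeas => z; rewrite ?lee_fin//.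
  by rewrite -lerBlDr le_max lexx orbT.
rewrite ge0_integralD//; first last.
- exact/measurable_EFinP.
- by move=> z _; rewrite lee_fin.
- exact/measurable_EFinP.
- by move=> z _; rewrite lee_fin.
rewrite leeD2r// unlock; apply: ge0_le_integral_nomeas => z; rewrite lee_fin//.
by rewrite ge_max c0/= lerBlDr; case: z => x y; exact: phicg.
Qed.

(** * Norms on row vectors and the distance to a set *)

Section norms.
Context (R : realType) (K : nat) (nrm : 'rV[R]_K -> R) (nrmP : is_norm nrm).

Lemma is_norm0 : nrm 0%R = 0%R.
Proof. by rewrite -(scale0r 0%R) (norm_homogeneous nrmP) normr0 mul0r. Qed.

Lemma is_normN x : nrm (- x)%R = nrm x.
Proof.
by rewrite -scaleN1r (norm_homogeneous nrmP) normrN normr1 mul1r.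
Qed.

Lemma is_norm_ge0 x : (0 <= nrm x)%R.
Proof.
have := norm_triangle nrmP x (- x)%R.
by rewrite subrr is_norm0 is_normN; lra.
Qed.

(** Half of the equivalence of norms, which makes [nrm] continuous for the
topology of the sup norm. *)
Lemma is_norm_bounded : {M | (0 < M)%R & forall x, (nrm x <= M * `|x|)%R}.
Proof.
pose M := (1 + \sum_(j < K) nrm (delta_mx ord0 j))%R.
have s0 : (0 <= \sum_(j < K) nrm (delta_mx ord0 j))%R.
  by apply: sumr_ge0 => j _; exact: is_norm_ge0.
exists M => [|x]; first by rewrite /M; lra.
have sub (I : Type) (r : seq I) (F : I -> 'rV[R]_K) :
    (nrm (\sum_(i <- r) F i) <= \sum_(i <- r) nrm (F i))%R.
  elim: r => [|i r IH]; first by rewrite !big_nil is_norm0.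
  rewrite !big_cons; apply: le_trans (norm_triangle nrmP _ _) _.
  by rewrite lerD2l.
have xM j : (`|x ord0 j| <= `|x|)%R.
  rewrite [leRHS]mx_normrE.
  exact: (le_bigmax _ (fun ij => `|x ij.1 ij.2|%R) (ord0, j)).
rewrite {1}(row_sum_delta x); apply: le_trans (sub _ _ _) _.
rewrite /M mulrDl mul1r mulr_suml ler_wpDl//.
apply: ler_sum => j _; rewrite (norm_homogeneous nrmP) mulrC.
by apply: ler_wpM2l => //; exact: is_norm_ge0.
Qed.

Lemma is_norm_open_ball (y : 'rV[R]_K) (r : R) :
  open [set z : 'rV[R]_K | (nrm (y - z) < r)%R].
Proof.
have [M M0 nM] := is_norm_bounded.
rewrite openE => z /= yzr; apply/nbhs_ballP.
exists ((r - nrm (y - z)) / M)%R => /=; first by rewrite divr_gt0// subr_gt0.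
move=> w; rewrite -ball_normE /= ltr_pdivlMr// => zw.
have := norm_triangle nrmP (y - z)%R (z - w)%R.
rewrite addrA subrK => /le_lt_trans; apply.
by have := nM (z - w)%R; rewrite mulrC; lra.
Qed.

Lemma dist_ge0 z C : 0 <= dist nrm z C.
Proof.
by apply: le_ereal_inf_tmp => _ [y Cy <-]; rewrite lee_fin is_norm_ge0.
Qed.

Lemma dist_le z (C : set 'rV[R]_K) y : C y -> dist nrm z C <= (nrm (y - z))%:E.
Proof. by move=> Cy; apply: ereal_inf_lbound; exists y. Qed.

Lemma dist_fin_num z (C : set 'rV[R]_K) y : C y -> dist nrm z C \is a fin_num.
Proof.
move=> Cy; rewrite ge0_fin_numE ?dist_ge0//.
exact: le_lt_trans (dist_le _ Cy) (ltry _).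
Qed.

(** The strict sublevel sets of the distance are unions of open balls, so the
distance is upper semicontinuous. *)
Lemma measurable_dist C :
  measurable_fun setT (fun z : borel_rV R K => dist nrm z C).
Proof.
apply: (measurability _ (ErealGenInftyO.measurableE R)).
move=> _ /= [_ [r ->] <-]; rewrite setTI; apply: sub_sigma_algebra.
have -> : (fun z => dist nrm z C) @^-1` `]-oo, r%:E[%classic =
    \bigcup_(y in C) [set z : 'rV[R]_K | (nrm (y - z) < r)%R].
  apply/seteqP; split => z /=; rewrite in_itv /=.
    by move=> /ereal_inf_lt[_ [y Cy <-]]; rewrite lte_fin => yzr; exists y.
  move=> [y Cy /= yzr].
  by apply: (le_lt_trans (dist_le _ Cy)); rewrite lte_fin.
by apply: bigcup_open => y _; exact: is_norm_open_ball.
Qed.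

End norms.

(** * Greedy allocation of a fractional number of samples *)

(** Number of units taken from index [i] when [l] units are to be taken from the
smallest indices first, at most one unit each. This is so for [m <= l <= m + 1];
leaving [m] as a parameter rather than rounding [l] down keeps the allocation
affine in [l] up to [l = m + 1] included. *)
Definition greedy (R : realType) (m : nat) (l : R) (i : nat) : R :=
  ((i < m)%N%:R + (i == m)%:R * (l - m%:R))%R.

Section greedy.
Context (R : realType) (N : nat) (m : 'I_N).
Implicit Types (l : R) (a : 'I_N -> R).

Lemma greedy_itv l (i : nat) :
  (m%:R <= l <= m.+1%:R)%R -> (0 <= greedy m l i <= 1)%R.
Proof. by rewrite /greedy -natr1; case: ltngtP => _ /=; lra. Qed.

Lemma sum_greedyE l a : (\sum_(i < N) greedy m l i * a i =
  \sum_(i < N | (i < m)%N) a i + (l - m%:R) * a m)%R.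
Proof.
rewrite [X in (X + _)%R]big_mkcond [X in (_ + X)%R](_ : _ =
  \sum_(i < N) if i == m then (l - m%:R) * a i else 0)%R.
  rewrite -big_split; apply: eq_bigr => i _ /=; rewrite /greedy -val_eqE /=.
  by case: ltnP => _; case: eqP => _ /=; ring.
by rewrite -big_mkcond big_pred1_eq.
Qed.

Lemma sum_greedy l : (\sum_(i < N) greedy m l i = l)%R.
Proof.
have := sum_greedyE l (fun=> 1%R).
under eq_bigr do rewrite mulr1.
move=> ->; rewrite mulr1 -(big_ord_widen N (fun=> 1%R) (ltnW (ltn_ord m))).
by rewrite sumr_const card_ord; ring.
Qed.

Lemma sum_greedyD l (e : R) a : (\sum_(i < N) greedy m (l + e) i * a i =
  \sum_(i < N) greedy m l i * a i + e * a m)%R.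
Proof. by rewrite !sum_greedyE; ring. Qed.

(** Complementary slackness: index by index, [max 0 (a m - a i)] equals
[greedy m l i * (a m - a i)], because [greedy] is [1] below [m], [0] above, and
[a m - a i] vanishes at [m]. *)
Lemma greedy_complementary l a : {homo a : i j / (i <= j)%N >-> (i <= j)%R} ->
  (\sum_(i < N) Num.max 0 (a m - a i) =
   a m * l - \sum_(i < N) greedy m l i * a i)%R.
Proof.
move=> a_nd; rewrite -{1}(sum_greedy l) mulr_sumr -sumrB.
apply: eq_bigr => i _; rewrite /greedy.
have [im|mi|/val_inj ->] := ltngtP i m; last by rewrite subrr maxxx; ring.
  by rewrite max_r ?subr_ge0 ?a_nd ?(ltnW im)//=; ring.
by rewrite max_l ?subr_le0 ?a_nd ?(ltnW mi)//=; ring.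
Qed.

Lemma fractional_sum_greedy l a : Num.truncn l = m ->
  fractional_sum l (fun i => (a i)%:E) = (\sum_(i < N) greedy m l i * a i)%:E.
Proof.
move=> lm; rewrite sum_greedyE /fractional_sum lm.
rewrite [in RHS]EFinD [in RHS]EFinM sumEFin.
by congr (_ + _ * _); rewrite (big_pred1 m).
Qed.

End greedy.

Lemma le_fractional_sum (R : realType) (N : nat) (l : R)
    (k1 k2 : 'I_N -> \bar R) : (0 <= l)%R ->
  (forall i, k1 i <= k2 i) -> fractional_sum l k1 <= fractional_sum l k2.
Proof.
move=> l0 k12; apply: leeD; first exact: lee_sum.
apply: lee_wpmul2l; last exact: lee_sum.
by rewrite lee_fin subr_ge0 Num.Theory.truncn_le.
Qed.

(** * Distributions reached by moving part of the mass of each atom *)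

(** The transport plan moves mass [w i] from [x i] to [y i] and leaves the
remaining [c i - w i] in place at no cost. *)
Lemma partial_transport (R : realType) (K : nat) (nrm : 'rV[R]_K -> R)
    (nrmP : is_norm nrm) (I : finType) (c : I -> {nonneg R}%R) (w : I -> R)
    (x y : I -> borel_rV R K) (P2 : probability (borel_rV R K) R) :
  (forall A, measurable A -> P2 A = \sum_i (c i)%:num%:E * \d_(x i) A) ->
  (forall i, 0 <= w i <= (c i)%:num)%R ->
  exists P : probability (borel_rV R K) R,
    (forall A, \sum_i (w i)%:E * \d_(y i) A <= P A) /\
    wasserstein nrm P P2 <=
      (\sum_i w i * nrm ((y i : 'rV[R]_K) - x i))%:E.
Proof.
move=> P2E w0c; pose T := borel_rV R K.
have u0 (ib : I * bool) :
    (0 <= if ib.2 then w ib.1 else (c ib.1)%:num - w ib.1)%R.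
  by case: ib => i [] /=; have /andP[] := w0c i; lra.
pose u ib := NngNum (u0 ib).
pose p (ib : I * bool) : T * T := (if ib.2 then y ib.1 else x ib.1, x ib.1).
have sumE (F : I * bool -> \bar R) :
    \sum_ib (u ib)%:num%:E * F ib =
    \sum_i ((w i)%:E * F (i, true) + ((c i)%:num - w i)%:E * F (i, false)).
  transitivity (\sum_i \sum_b (u (i, b))%:num%:E * F (i, b)).
    by rewrite pair_bigA; apply: eq_bigr => -[].
  by apply: eq_bigr => i _; rewrite big_bool.
have c1 : (\sum_i (c i)%:num = 1)%R.
  have := P2E setT measurableT; rewrite probability_setT => /esym.
  under eq_bigr do rewrite diracT mule1.
  by rewrite sumEFin => -[].
have u1 : (\sum_ib (u ib)%:num = 1)%R.
  apply: EFin_inj; rewrite -sumEFin.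
  rewrite (eq_bigr (fun ib => (u ib)%:num%:E * 1)); last first.
    by move=> ib _; rewrite mule1.
  rewrite (sumE (fun=> 1)) -[in RHS]c1 -sumEFin; apply: eq_bigr => i _.
  by rewrite /= !mule1 -EFinD addrC subrK.
have [Q QE] := discrete_probability p u1.
have [P PE] := discrete_probability (fst \o p) u1.
exists P; split => [A|].
  rewrite PE sumE; apply: lee_sum => i _ /=.
  rewrite leeDl// mule_ge0// lee_fin subr_ge0.
  by have /andP[] := w0c i.
pose cost (z : T * T) := nrm ((z.1 : 'rV[R]_K) - z.2)%R.
apply: ge_ereal_inf; exists ('E_Q[cost]).
  exists Q => //; split => A mA; first by rewrite QE PE.
  rewrite QE P2E// sumE; apply: eq_bigr => i _.
  rewrite [X in _ * X + _]/dirac [X in _ + _ * X]/dirac /=.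
  rewrite -ge0_muleDl ?lee_fin ?subr_ge0; try by case/andP: (w0c i).
  by rewrite -EFinD addrC subrK.
rewrite unlock; apply: (le_trans (integral_discrete_le (fun A _ => QE A) _)).
  by move=> z; rewrite lee_fin is_norm_ge0.
rewrite (sumE (fun ib => (cost (p ib))%:E)) -sumEFin.
apply: lee_sum => i _ /=.
by rewrite /cost /= subrr (is_norm0 nrmP) mule0 adde0 EFinM.
Qed.

(** * The chance constraint over the ambiguity set *)

Lemma empiricalE (R : realType) (K N : nat) (N0 : (0 < N)%N)
    (xi : 'I_N -> 'rV[R]_K) (A : set (borel_rV R K)) :
  empirical N0 xi A =
  \sum_(i < N) ((N%:R^-1)%:nng%R : {nonneg R}%R)%:num%:E *
    \d_(xi i : borel_rV R K) A.
Proof. by rewrite /empirical ge0_sume_distrr. Qed.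

Section chance_constraint.
Context (R : realType) (K N : nat) (N0 : (0 < N)%N).
Context (nrm : 'rV[R]_K -> R) (nrmP : is_norm nrm).
Context (xi : 'I_N -> 'rV[R]_K) (C : set 'rV[R]_K) (theta eps : R).
Context (s : {perm 'I_N}) (m : 'I_N).

Let a (i : 'I_N) : R := fine (dist nrm (xi (s i)) C).
Let l : R := (eps * N%:R)%R.
Let S : R := (\sum_(i < N) greedy m l i * a i)%R.

Hypothesis dist_sorted : forall i j : 'I_N, (i <= j)%N ->
  dist nrm (xi (s i)) C <= dist nrm (xi (s j)) C.
Hypothesis C0 : C !=set0.

Let a0 i : (0 <= a i)%R.
Proof. exact/fine_ge0/(dist_ge0 nrmP). Qed.

Let aE i : dist nrm (xi (s i)) C = (a i)%:E.
Proof. by case: C0 => y Cy; rewrite fineK// (dist_fin_num nrmP _ Cy). Qed.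

Let a_nd : {homo a : i j / (i <= j)%N >-> (i <= j)%R}.
Proof. by move=> i j /dist_sorted; rewrite !aE lee_fin. Qed.

Let Npos : (0 < N%:R :> R)%R. Proof. by rewrite ltr0n. Qed.

(** Linear programming duality: [lam], the marginal price of mass in [C] once [eps]
has been moved there, is the dual variable of the amount [P C]. *)
Lemma chance_le (P : probability (borel_rV R K) R) :
  (0 < theta)%R -> measurable (C : set (borel_rV R K)) ->
  ambiguity_set N0 nrm xi theta P -> (theta <= N%:R^-1 * S)%R ->
  P C <= eps%:E.
Proof.
move=> theta0 mC PF thetaS; pose lam := a m.
pose g (z : borel_rV R K) : R := Num.max 0%R (lam - fine (dist nrm z C))%R.
have SE : (\sum_(i < N) Num.max 0 (lam - a i) = lam * l - S)%R.
  exact: greedy_complementary.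
have gsum : (\sum_(i < N) N%:R^-1 * g (xi i) = lam * eps - N%:R^-1 * S)%R.
  rewrite -mulr_sumr (reindex_inj (@perm_inj _ s)) SE /l.
  by field; rewrite gt_eqF.
have g0 z : (0 <= g z)%R by rewrite le_max lexx.
(* A zero price would make the greedy cost zero, below [theta]. *)
have lam0 : (0 < lam)%R.
  rewrite lt_neqAle a0 andbT; apply/eqP => lamE.
  have : (0 <= lam * eps - N%:R^-1 * S)%R.
    by rewrite -gsum; apply: sumr_ge0 => i _; rewrite mulr_ge0// invr_ge0 ltW.
  by rewrite -lamE mul0r sub0r oppr_ge0 leNgt (lt_le_trans theta0 thetaS).
have mg : measurable_fun setT g.
  apply: measurable_maxr => //; apply: measurable_funB => //.
  apply: measurableT_comp; last exact: measurable_dist.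
  exact: fine_measurable.
pose p := fine (P C).
have pE : P C = p%:E by rewrite fineK// fin_num_measure.
pose phi (z : borel_rV R K) : R := (lam * \1_C z)%R.
have mphi : measurable_fun setT phi.
  by apply: measurable_funM => //; exact: measurable_indic.
have phi0 z : (0 <= phi z)%R by rewrite mulr_ge0// ltW.
have phiE : \int[P]_z (phi z)%:E = (lam * p)%:E.
  under eq_integral do rewrite EFinM.
  rewrite ge0_integralZl//; first by rewrite integral_indic// setIT EFinM -pE.
  - exact/measurable_EFinP.
  - by rewrite lee_fin ltW.
have bound : (lam * p - (lam * eps - N%:R^-1 * S))%:E <=
    wasserstein nrm P (empirical N0 xi).
  apply: le_ereal_inf_tmp => _ [Q Qc <-].
  rewrite EFinB leeBlDr//.
  (* On [C] the cost is at least the distance of [y] to [C]; off [C] the left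
     side vanishes. *)
  have dual x y : (phi x <= nrm ((x : 'rV[R]_K) - y) + g y)%R.
    rewrite /phi indicE.
    have [/set_mem Cx|_] := boolP (x \in C); last first.
      by rewrite mulr0 addr_ge0// is_norm_ge0.
    have := dist_le nrm y Cx; rewrite -(fineK (dist_fin_num nrmP y Cx)) lee_fin.
    have : (lam - fine (dist nrm y C) <= g y)%R by rewrite le_max lexx orbT.
    by rewrite mulr1; lra.
  rewrite -phiE.
  pose cost z := nrm ((z.1 : 'rV[R]_K) - z.2)%R.
  have cost0 z : (0 <= cost z)%R by exact: is_norm_ge0.
  apply: le_trans (kantorovich_weak_duality Qc mphi mg phi0 g0 cost0 dual) _.
  apply: leeD => //; rewrite -gsum -sumEFin.
  apply: le_trans (integral_discrete_le (fun A _ => empiricalE N0 xi A) _) _.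
    by move=> z; rewrite lee_fin.
  by apply: lee_sum => i _; rewrite EFinM.
have := le_trans bound PF; rewrite lee_fin => pth.
rewrite pE lee_fin -(ler_pM2l lam0).
by move: thetaS; lra.
Qed.

(** The slack [theta - S / N] is split in halves: one pays for replacing closest
points of [C] by [eta]-nearly closest ones, the other for the extra [e] units
of mass, priced [a m] each, which make the mass in [C] exceed [eps]. *)
Lemma chance_gt : (m%:R <= l < m.+1%:R)%R -> (N%:R^-1 * S < theta)%R ->
  exists2 P : probability (borel_rV R K) R,
    ambiguity_set N0 nrm xi theta P & eps%:E < P C.
Proof.
move=> lm Stheta; pose eta := ((theta - N%:R^-1 * S) / 2)%R.
have eta0 : (0 < eta)%R by rewrite divr_gt0// subr_gt0.
have /choice[y yP] (i : 'I_N) :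
    exists y, C y /\ (nrm (y - xi (s i)) <= a i + eta)%R.
  have : dist nrm (xi (s i)) C < (a i + eta)%:E by rewrite aE lte_fin; lra.
  move=> /ereal_inf_lt[_ [y Cy <-]]; rewrite lte_fin => /ltW ylt.
  by exists y.
(* The first bound keeps the allocation within [greedy_itv]; the [+ 1] only
   avoids dividing by zero. *)
pose e := Num.min (m.+1%:R - l)%R (eta * N%:R / (a m + 1))%R.
have am1 : (0 < a m + 1)%R by rewrite ltr_wpDl.
have e0 : (0 < e)%R.
  by rewrite lt_min subr_gt0 (andP lm).2 divr_gt0// mulr_gt0.
have lem : (m%:R <= l + e <= m.+1%:R)%R.
  have : (e <= m.+1%:R - l)%R by rewrite ge_min lexx.
  by move: lm => /andP[? ?]; lra.
have eam : (e * a m <= eta * N%:R)%R.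
  have : (e <= eta * N%:R / (a m + 1))%R by rewrite ge_min lexx orbT.
  by rewrite ler_pdivlMr//; lra.
pose w i : R := (N%:R^-1 * greedy m (l + e) i)%R.
have w01 (i : 'I_N) : (0 <= w i <= ((N%:R^-1)%:nng : {nonneg R})%:num)%R.
  have /andP[gr0 gr1] := greedy_itv i lem.
  rewrite /= mulr_ge0 ?invr_ge0 ?(ltW Npos)//= -[leRHS]mulr1.
  by rewrite ler_wpM2l// invr_ge0 ltW.
have empE A : measurable A -> (empirical N0 xi : probability _ R) A =
    \sum_(i < N) ((N%:R^-1)%:nng%R : {nonneg R}%R)%:num%:E *
      \d_(xi (s i) : borel_rV R K) A.
  by move=> _; rewrite [LHS]empiricalE (reindex_inj (@perm_inj _ s)).
have [P [PC PW]] := partial_transport nrmP y empE w01.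
have Npm : (m.+1%:R <= N%:R :> R)%R by rewrite ler_nat.
exists P.
  apply: le_trans PW _; rewrite lee_fin.
  apply: (@le_trans _ _ (\sum_(i < N) w i * (a i + eta)))%R.
    apply: ler_sum => i _; apply: ler_wpM2l; last by have [] := yP i.
    by have /andP[] := w01 i.
  under eq_bigr do rewrite -mulrA mulrDr.
  rewrite -mulr_sumr big_split /= -mulr_suml sum_greedy sum_greedyD -/S.
  have leN : ((l + e) * eta <= N%:R * eta)%R.
    by apply: ler_wpM2r; [exact: ltW|move: lem => /andP[? ?]; lra].
  have -> : theta = (N%:R^-1 * (S + 2 * (eta * N%:R)))%R.
    by rewrite /eta; field; rewrite gt_eqF.
  rewrite ler_pM2l ?invr_gt0//.
  by move: leN eam; lra.
apply: lt_le_trans (PC C).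
rewrite (eq_bigr (fun i : 'I_N => (w i)%:E)); last first.
  by move=> i _; rewrite diracE mem_set ?mule1//; have [] := yP i.
rewrite sumEFin -mulr_sumr sum_greedy lte_fin mulrC ltr_pdivlMr//.
by rewrite ltrDl.
Qed.

End chance_constraint.

Unset Implicit Arguments.
Set Strict Implicit.

Theorem theorem2 (R : realType) (K L N : nat) (N0 : (0 < N)%N)
  (nrm : 'rV[R]_K -> R) (nrmP : is_norm nrm)
  (xi : 'I_N -> 'rV[R]_K)
  (X : set 'rV[R]_L) (Xcompact : compact X) (Xpoly : polyhedron X)
  (safe : 'rV[R]_L -> set 'rV[R]_K) (safe_open : forall x, X x -> open (safe x))
  (pi : 'rV[R]_L -> {perm 'I_N})
  (pi_sorted : forall x, X x -> forall i j : 'I_N, (i <= j)%N ->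
     dist nrm (xi (pi x i)) (~` safe x) <= dist nrm (xi (pi x j)) (~` safe x))
  (theta eps : R) (theta0 : (0 < theta)%R) (eps0 : (0 < eps)%R)
  (eps1 : (eps < 1)%R)
  (x : 'rV[R]_L) (Xx : X x) :
  ereal_sup [set (P : probability (borel_rV R K) R) (~` safe x)
            | P in ambiguity_set N0 nrm xi theta] <= eps%:E
  <->
  theta%:E <= (N%:R^-1)%:E *
    fractional_sum (eps * N%:R)%R
      (fun i : 'I_N => dist nrm (xi (pi x i)) (~` safe x)).
Proof.
have Npos : (0 < N%:R :> R)%R by rewrite ltr0n.
have l0 : (0 <= eps * N%:R)%R by rewrite mulr_ge0 ?ltW.
have lm := truncn_itv l0.
have mN : (Num.truncn (eps * N%:R)%R < N)%N.
  rewrite -(ltr_nat R); apply: le_lt_trans (andP lm).1 _.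
  by rewrite gtr_pMl.
pose m := Ordinal mN.
have [C0|/set0P C0] := eqVneq (~` safe x) set0.
  split=> _.
    (* All distances are infinite; replacing them by the constant [theta / eps]
       already gives [theta] on the right. *)
    pose k (i : 'I_N) : R := (theta / eps)%R.
    apply: (@le_trans _ _ ((N%:R^-1)%:E *
        fractional_sum (eps * N%:R)%R (fun i => (k i)%:E))).
      rewrite (@fractional_sum_greedy _ _ m)// -mulr_suml sum_greedy -EFinM.
      rewrite lee_fin le_eqVlt; apply/orP; left; apply/eqP.
      by field; rewrite !gt_eqF.
    apply: lee_wpmul2l; first by rewrite lee_fin invr_ge0 ltW.
    apply: le_fractional_sum => // i.
    by rewrite C0 /dist image_set0 ereal_inf0 leey.
  apply: ge_ereal_sup => _ [P _ <-].
  by rewrite C0 measure0 lee_fin ltW.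
pose a (i : 'I_N) : R := fine (dist nrm (xi (pi x i)) (~` safe x)).
have aE : (fun i : 'I_N => dist nrm (xi (pi x i)) (~` safe x)) =
    (fun i => (a i)%:E).
  apply/funext => i; case: C0 => y Cy.
  by rewrite fineK// (dist_fin_num nrmP _ Cy).
rewrite aE (@fractional_sum_greedy _ _ m)// -EFinM lee_fin; split.
  move=> supP; rewrite leNgt; apply/negP.
  move=> /(chance_gt (m := m) N0 nrmP C0 lm)[P PF]; apply/negP; rewrite -leNgt.
  by apply: le_trans supP; apply: ereal_sup_ubound; exists P.
move=> thetaS; apply: ge_ereal_sup => _ [P PF <-].
apply: (chance_le nrmP (pi_sorted x Xx) C0 theta0 _ PF thetaS).
by apply: measurableC; apply: sub_sigma_algebra; exact: safe_open.
Qed.
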